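(* Let $G$ be an $n$-vertex graph with diameter $D$. For any $s\in V(G)$, we have $\tau(G,s)\le 4\ln n+2D$ with probability at least $1-1/n$.
   Context: All graphs are finite, simple, undirected and connected. First-passage percolation: assign independent exponential random variables $\tau(e)$ of mean $1$ to the edges $e$ of $G$. For a path $\gamma$ put $\tau(\gamma)=\sum_{e\in\gamma}\tau(e)$. For $s,v\in V(G)$ let $\Gamma(s,v)$ be the set of all $(s,v)$-paths in $G$, let $\tau(G,s,v)=\min_{\gamma\in\Gamma(s,v)}\tau(\gamma)$, and let the first-passage percolation cover time be $\tau(G,s)=\max_{v\in V(G)}\tau(G,s,v)$. $\ln$ is the natural logarithm. *)

(* Defs.v *)
(* A finite simple graph on the vertex type V is
   given by its adjacency relation e : rel V, assumed symmetric and irreflexive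
   where it matters. *)
From HB Require Import structures.
From mathcomp Require Import all_boot all_order all_algebra.
From mathcomp Require Import all_classical all_reals all_analysis.

Set Implicit Arguments.
Unset Strict Implicit.
Unset Printing Implicit Defensive.

Import Order.TTheory GRing.Theory Num.Theory.

Local Open Scope ring_scope.

Section Graph.
Variables (V : finType) (e : rel V).

Definition graph_connected : Prop := forall x y : V, connect e x y.

Definition edge_set : {set {set V}} :=
  [set [set p.1; p.2] | p : V * V & e p.1 p.2].

Definition edge : finType := {a : {set V} | a \in edge_set}.

(* A path is a sequence of distinct vertices u, p_1, ..., p_k with consecutive
   ones adjacent, represented by its tail p once u is fixed.  Distinctness gives
   k < #|V|, so bounding the size of p by #|V| loses no path. *)
Definition gpaths (u v : V) : {set #|V|.-bseq V} :=
  [set p : #|V|.-bseq V | [&& path e u p, uniq (u :: p) & last u p == v]].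

Definition path_edges (u : V) (p : seq V) : seq {set V} :=
  pairmap (fun x y => [set x; y]) u p.

(* The default value #|V| exceeds the length of every path; it is only reached
   when u and v are not connected. *)
Definition gdist (u v : V) : nat :=
  \big[minn/#|V|]_(p in gpaths u v) size p.

Definition diameter : nat := \max_(u : V) \max_(v : V) gdist u v.

End Graph.

Section FirstPassage.
Variables (V : finType) (e : rel V) (R : realType) (t : edge e -> R).

Definition path_time (u : V) (p : seq V) : R :=
  \sum_(a : edge e | val a \in path_edges u p) t a.

(* The neutral elements +oo and -oo are never reached in a connected graph:
   every gpaths e s v is then non-empty, and so is V. *)
Definition passage_time (s v : V) : \bar R :=
  \big[Order.min/+oo%E]_(p in gpaths e s v) (path_time s p)%:E.

Definition cover_time (s : V) : \bar R :=
  \big[Order.max/-oo%E]_(v : V) passage_time s v.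

End FirstPassage.

Section RandomVariables.
Local Open Scope classical_set_scope.
Context d (T : measurableType d) (R : realType) (P : probability T R).

Definition mutually_independent (I : finType) (X : I -> {RV P >-> R}) : Prop :=
  forall (J : {set I}) (B : I -> set R), (forall i, measurable (B i)) ->
    P [set w | forall i, i \in J -> B i (X i w)] =
    (\prod_(i in J) P [set w | B i (X i w)])%E.

(* The rate is the inverse of the mean.  Laws are compared on measurable sets
   only: outside them both measures take unspecified values. *)
Definition exponential_of_mean (m : R) (X : {RV P >-> R}) : Prop :=
  forall A : set R, measurable A ->
    distribution P X A = exponential_prob m^-1 A.

End RandomVariables.

(* Main.v *)
Require Import Defs.
From HB Require Import structures.
From mathcomp Require Import all_boot all_order all_algebra.
From mathcomp Require Import all_classical all_reals all_analysis.
From mathcomp Require Import measurable_realfun ring lra.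

Set Implicit Arguments.
Unset Strict Implicit.
Unset Printing Implicit Defensive.

Import Order.TTheory GRing.Theory Num.Theory.

Local Open Scope classical_set_scope.
Local Open Scope ring_scope.

(** Fix, for every vertex v, a shortest path from s to v; it has at most D
    edges, and its passage time is at least the distance tau(G, s, v). So the
    cover time can exceed x = 4 ln n + 2 D only if one of these n paths takes
    time at least x ([cover_time_le]).

    A path with k <= D edges has as passage time a sum of k independent
    exponential variables of mean 1.  Each of them satisfies
    E[exp(tau / 2)] = 2 ([expectation_expR_exponential]), so independence
    ([integral_prod_independent]) and the Chernoff bound
    ([exponential_sum_tail]) show that the path takes time at least x with
    probability at most
      2^k exp(- x / 2) = 2^k e^(-D) n^(-2) <= (2 / e)^D n^(-2) <= n^(-2),
    and the union bound over the n vertices leaves 1 / n.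

    Independence is given as a product rule for events.  To pass from events to
    products of functions, one factor at a time is changed from an indicator
    into an arbitrary nonnegative function: the product of the other factors is
    a weight, and two measures which agree on measurable sets have the same
    integrals ([ge0_integral_weighted_pushforward]).  The same lemma turns the
    density of the exponential law into a formula for its expectations. *)

(** * Integrals against a weighted image of a measure *)

Section WeightedPushforward.
Local Open Scope ereal_scope.
Context d d' (T : measurableType d) (T' : measurableType d') (R : realType).
Variables (mu : {measure set T -> \bar R}) (nu : {measure set T' -> \bar R}).
Variables (w : T -> R) (X : T -> T').
Hypotheses (w_ge0 : forall x, (0 <= w x)%R) (mw : measurable_fun setT w).
Hypothesis mX : measurable_fun setT X.
Hypothesis nuE :
  forall B, measurable B -> \int[mu]_x (w x * \1_B (X x))%:E = nu B.

Import HBNNSimple.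

(* By linearity, the hypothesis on indicators extends to simple functions. *)
Let nnsfunE (h : {nnsfun T' >-> R}) :
  \int[mu]_x (w x * h (X x))%:E = \int[nu]_y (h y)%:E.
Proof.
have mh k : measurable (h @^-1` [set k]) by [].
rewrite integralT_nnsfun sintegralE.
transitivity (\int[mu]_x (\sum_(k \in range h)
    k%:E * (w x * \1_(h @^-1` [set k]) (X x))%:E)%E).
  apply: eq_integral => x _; rewrite {1}fimfunE EFinM.
  rewrite -fsumEFin// ge0_mule_fsumr; last first.
    by move=> k; exact: nnfun_muleindic_ge0.
  by apply: eq_fsbigr => k _; rewrite -!EFinM mulrCA.
have mwk k : measurable_fun setT
    (fun x => (w x * \1_(h @^-1` [set k]) (X x))%:E : \bar R).
  apply/measurable_EFinP; apply: measurable_funM => //.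
  by apply: measurableT_comp mX; exact: measurable_indic.
rewrite ge0_integral_fsum//; last 2 first.
- by move=> k; exact: measurable_funeM.
- move=> k x _; have [k0|k0] := ltP k 0%R.
    by rewrite preimage_nnfun0// indicE in_set0 mulr0 mule0.
  by rewrite mule_ge0// lee_fin mulr_ge0.
apply: eq_fsbigr => k; rewrite inE => -[y _ <-].
by rewrite ge0_integralZl ?nuE// => [x _|]; rewrite lee_fin// mulr_ge0.
Qed.

(** If the image under [X] of the measure with density [w] is [nu] on sets, then
    it is [nu] for integrals: simple functions are combinations of indicators,
    and an increasing sequence of them passes to the limit on both sides by
    monotone convergence. *)
Lemma ge0_integral_weighted_pushforward (f : T' -> \bar R) :
    measurable_fun setT f -> (forall y, 0 <= f y) ->
  \int[mu]_x ((w x)%:E * f (X x)) = \int[nu]_y f y.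
Proof.
move=> mf f0; pose h := nnsfun_approx measurableT mf.
have hf y : EFin \o h^~ y @ \oo --> f y by exact: cvg_nnsfun_approx.
transitivity (limn (fun n => \int[nu]_y (h n y)%:E)).
  transitivity (limn (fun n => \int[mu]_x (w x * h n (X x))%:E)); last first.
    by congr (limn _); apply/funext => n; exact: nnsfunE.
  rewrite -monotone_convergence//.
  - apply: eq_integral => x _; apply/esym/cvg_lim => //.
    rewrite (_ : (fun n => _) = (fun n => (w x)%:E * (h n (X x))%:E))//.
    by apply: cvgeZl => //; exact: hf.
  - move=> n; apply/measurable_EFinP; apply: measurable_funM => //.
    exact: measurableT_comp mX.
  - by move=> n x _; rewrite lee_fin mulr_ge0.
  - move=> x _ m n mn; rewrite lee_fin ler_wpM2l//.
    exact/lefP/nd_nnsfun_approx.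
rewrite -monotone_convergence//.
- by apply: eq_integral => y _; apply/cvg_lim => //; exact: hf.
- by move=> n; exact/measurable_EFinP.
- by move=> n y _; rewrite lee_fin.
- by move=> y _ m n mn; rewrite lee_fin; exact/lefP/nd_nnsfun_approx.
Qed.

End WeightedPushforward.

(** * Products of independent variables *)

Section Independence.
Local Open Scope ereal_scope.
Context d (T : measurableType d) (R : realType) (P : probability T R).

Lemma integral_indic_RV (X : {RV P >-> R}) (B : set R) : measurable B ->
  \int[P]_w (\1_B (X w))%:E = P [set w | B (X w)].
Proof.
move=> mB; rewrite -[X in _ = P X]setIT -integral_indic//.
by rewrite -[X in measurable X]setTI; exact: measurable_funPT.
Qed.

(** The induction is on the list [s] of the indices whose factor may be
    arbitrary, all the others being indicators. When [s] is empty the claim is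
    the product rule for events. When [a] joins [s], the claim is already
    known with any indicator as the factor at [a]; read with the remaining
    factors as a weight, it says that the weighted law of [X a] is a multiple
    of the law of [X a], and so it holds with any nonnegative measurable
    factor at [a]. *)
Lemma integral_prod_independent (I : finType) (X : I -> {RV P >-> R})
    (f : I -> R -> R) :
    mutually_independent X ->
    (forall i, measurable_fun setT (f i)) -> (forall i x, (0 <= f i x)%R) ->
    (forall i, \int[P]_w (f i (X i w))%:E < +oo) ->
  \int[P]_w (\prod_i f i (X i w))%:E = \prod_i \int[P]_w (f i (X i w))%:E.
Proof.
move=> indX mf f0 foo.
suff H (s : seq I) (g : I -> R -> R) :
    (forall i, measurable_fun setT (g i)) -> (forall i x, (0 <= g i x)%R) ->
    (forall i, \int[P]_w (g i (X i w))%:E < +oo) ->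
    (forall i, i \notin s -> exists B, measurable B /\ g i = \1_B) ->
  \int[P]_w (\prod_i g i (X i w))%:E = \prod_i \int[P]_w (g i (X i w))%:E.
  by apply: (H (enum I)) => // i; rewrite mem_enum.
elim: s g => [|a s IH] g mg g0 goo gB.
  have /choice[B BP] i := gB i isT.
  have mXB i : measurable [set w | B i (X i w)].
    rewrite -[X in measurable X]setTI; apply: measurable_funPT => //.
    by case: (BP i).
  pose E := [set w | forall i, i \in [set: I]%SET -> B i (X i w)].
  transitivity (P E); last first.
    rewrite [LHS](indX [set: I]%SET B (fun i => (BP i).1)).
    apply: eq_big => [i|i _]; first by rewrite finset.in_setT.
    by rewrite (BP i).2 integral_indic_RV//; exact: (BP i).1.
  have -> : (fun w => (\prod_i g i (X i w))%:E) = (fun w => (\1_E w)%:E).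
    apply/funext => w; congr (_%:E); rewrite indicE.
    have [wE|wE] := boolP (w \in E).
      rewrite big1// => i _; rewrite (BP i).2 indicE mem_set//.
      by move: wE; rewrite inE; apply; rewrite finset.in_setT.
    have [i nB] : exists i, ~ B i (X i w).
      apply/existsNP => wB; move/negP: wE; apply.
      by rewrite inE => i _; exact: wB.
    by rewrite (bigD1 i)//= (BP i).2 indicE memNset// mul0r.
  rewrite integral_indic ?setIT//.
  have -> : E = \bigcap_(i in [set: I]) [set w | B i (X i w)].
    by apply/seteqP; split=> w wE i _; apply: wE; rewrite ?finset.in_setT.
  by apply: fin_bigcap_measurable => [|i _]; [exact: finite_finset|exact: mXB].
(* The weight [w] and its total mass [c], which has to be finite to scale the
   law of [X a]. *)
pose w x := (\prod_(i | i != a) g i (X i x))%R.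
have w0 x : (0 <= w x)%R by exact: prodr_ge0.
have mgX i : measurable_fun setT (fun x => g i (X i x)).
  by apply: measurableT_comp (mg i) _.
have mw : measurable_fun setT w.
  rewrite /w; under eq_fun do rewrite -big_filter.
  by apply: measurable_prod => i _.
have G0 i : 0 <= \int[P]_x (g i (X i x))%:E.
  by apply: integral_ge0 => x _; rewrite lee_fin.
pose c : R := (\prod_(i | i != a) fine (\int[P]_x (g i (X i x))%:E))%R.
have c0 : (0 <= c)%R by apply: prodr_ge0 => i _; exact: fine_ge0.
have cE : \prod_(i | i != a) \int[P]_x (g i (X i x))%:E = c%:E.
  rewrite /c -prodEFin; apply: eq_bigr => i _.
  by rewrite fineK// ge0_fin_numE.
rewrite [RHS](bigD1 a)//= cE muleC.
under eq_integral do rewrite (bigD1 a)//= mulrC EFinM.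
have mXa : measurable_fun setT (X a) by exact: measurable_funPT.
have mga : measurable_fun setT (fun y => (g a y)%:E) by exact/measurable_EFinP.
have ga0 y : 0 <= (g a y)%:E by rewrite lee_fin.
have weighted B : measurable B -> \int[P]_x (w x * \1_B (X a x))%:E =
    mscale (NngNum c0) (distribution P (X a)) B.
  move=> mB; pose g' i := if i == a then \1_B else g i.
  transitivity (\int[P]_x (\prod_i g' i (X i x))%:E).
    apply: eq_integral => x _; rewrite (bigD1 a)//= {1}/g' eqxx mulrC.
    by congr (_ * _)%:E; apply: eq_bigr => i /negbTE ia; rewrite /g' ia.
  rewrite IH.
  - rewrite (bigD1 a)//= {1}/g' eqxx integral_indic_RV// muleC.
    congr (_ * _); rewrite -cE; apply: eq_bigr => i /negbTE ia.
    by rewrite /g' ia.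
  - by move=> i; rewrite /g'; case: eqP => // _; exact: measurable_indic.
  - by move=> i x; rewrite /g'; case: eqP => // _; rewrite indicE.
  - move=> i; rewrite /g'; case: eqP => // _; rewrite integral_indic_RV//.
    apply: le_lt_trans (probability_le1 P _) (ltry _).
    exact: measurable_funPTI.
  - move=> i si; rewrite /g'; case: eqP => [_|/eqP ia]; first by exists B.
    by apply: gB; rewrite inE negb_or ia.
rewrite (ge0_integral_weighted_pushforward w0 mw mXa weighted mga)//.
rewrite ge0_integral_mscale//.
by rewrite (ge0_integral_distribution (X a) mga ga0).
Qed.

End Independence.

(** * Sums of independent exponential variables *)

Section Exponential.
Local Open Scope ereal_scope.
Context d (T : measurableType d) (R : realType) (P : probability T R).

(** Multiplying the density of rate 1 / m by exp (theta x) gives, up to a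
    constant, the exponential density of rate 1 / m - theta, of integral 1. *)
Lemma expectation_expR_exponential (m : R) (X : {RV P >-> R}) (theta : R) :
    (0 < m)%R -> (theta * m < 1)%R -> exponential_of_mean m X ->
  \int[P]_w (expR (theta * X w))%:E = ((1 - theta * m)^-1)%:E.
Proof.
move=> m0 thm expX.
have mexp : measurable_fun [set: R] (fun x => (expR (theta * x))%:E).
  by apply/measurable_EFinP; exact: measurableT_comp.
rewrite -(@ge0_integral_distribution _ _ _ _ _ P X
  (fun x => (expR (theta * x))%:E))//.
have mV0 : (0 < m^-1)%R by rewrite invr_gt0.
pose rate := (m^-1 - theta)%R.
have rate0 : (0 < rate)%R.
  by rewrite subr_gt0 -[X in (_ < X)%R]div1r ltr_pdivlMr.
have w0 x : (0 <= exponential_pdf m^-1 x)%R.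
  by rewrite exponential_pdf_ge0// ltW.
have density (B : set R) : measurable B -> \int[lebesgue_measure]_x
    (exponential_pdf m^-1 x * \1_B (id x))%:E = distribution P X B.
  move=> mB; rewrite [RHS]expX// /exponential_prob [RHS]integral_mkcond.
  apply: eq_integral => x _; rewrite patchE indicE.
  by case: ifPn => _; rewrite ?mulr1 ?mulr0.
rewrite -(@ge0_integral_weighted_pushforward _ _ (measurableTypeR R) R R
  lebesgue_measure (distribution P X) _ _ w0
  (measurable_exponential_pdf _) (@measurable_id _ _ _) density _ mexp)//.
transitivity (\int[lebesgue_measure]_x
    ((m^-1 / rate)%:E * (exponential_pdf rate x)%:E)).
  apply: eq_integral => x _; rewrite -!EFinM; congr (_%:E).
  have [x0|x0] := ltP x 0%R.
    by rewrite !lt0_exponential_pdf// mul0r mulr0.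
  rewrite !exponential_pdfE// -mulrA -expRD.
  rewrite mulrA divfK ?gt_eqF//; congr (_ * expR _)%R.
  by rewrite /rate; ring.
rewrite ge0_integralZl//; first last.
- by rewrite lee_fin divr_ge0// ltW.
- by move=> x _; rewrite lee_fin exponential_pdf_ge0// ltW.
- by apply/measurable_EFinP; exact: measurable_exponential_pdf.
rewrite integral_exponential_pdf// mule1; congr (_%:E).
rewrite /rate; field.
by rewrite subr_eq0 gt_eqF// ?gt_eqF.
Qed.

End Exponential.

Section ExponentialSums.
Local Open Scope ereal_scope.
Context d (T : measurableType d) (R : realType) (P : probability T R).
Variables (I : finType) (X : I -> {RV P >-> R}) (m : R).
Hypotheses (m_gt0 : (0 < m)%R) (indX : mutually_independent X).
Hypothesis expX : forall i, exponential_of_mean m (X i).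

(** Chernoff bound with parameter [theta]: by independence, the moment
    generating function of the sum is the product of those of its terms. *)
Lemma exponential_sum_tail (J : pred I) (theta x : R) :
    (0 < theta)%R -> (theta * m < 1)%R ->
  P [set w | (x <= \sum_(i | J i) X i w)%R] <=
    ((1 - theta * m)^-1 ^+ #|J| * expR (- (theta * x)))%:E.
Proof.
move=> theta0 thm.
have mS : measurable_fun setT (fun w => \sum_(i | J i) X i w)%R.
  by under eq_fun do rewrite -big_filter; exact: measurable_sum.
pose S : {RV P >-> R} := HB.pack (fun w => \sum_(i | J i) X i w)%R
  (isMeasurableFun.Build _ _ _ _ _ mS).
apply: le_trans (chernoff S x theta0) _.
rewrite EFinM lee_wpmul2r ?lee_fin ?expR_ge0// /mmt_gen_fun unlock.
(* Indices outside [J] get the factor 1, so that the product runs over [I]. *)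
pose f i (y : R) : R := if J i then expR (theta * y) else 1%R.
have mgf i : \int[P]_w (f i (X i w))%:E =
    (if J i then (1 - theta * m)^-1%R else 1%R)%:E.
  rewrite /f; case: (J i); first exact: expectation_expR_exponential.
  by rewrite integral_cst// mul1e [LHS]probability_setT.
have -> : \int[P]_w ((expR \o theta \o* S) w)%:E =
    \int[P]_w (\prod_i f i (X i w))%:E.
  apply: eq_integral => w _; congr (_%:E) => /=.
  by rewrite mulr_suml expR_sum [LHS]big_mkcond; under eq_bigr do rewrite mulrC.
rewrite integral_prod_independent//.
- rewrite (eq_bigr _ (fun i _ => mgf i)) prodEFin -big_mkcond/=.
  by rewrite prodr_const.
- move=> i; rewrite /f; case: (J i) => //.
  by apply: measurableT_comp => //; exact: measurable_funM.
- by move=> i y; rewrite /f; case: ifP => _; rewrite ?expR_ge0.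
- by move=> i; rewrite mgf ltry.
Qed.

End ExponentialSums.

(** * Shortest paths and passage times *)

Section Geodesic.
Variables (V : finType) (e : rel V).
Hypothesis e_conn : graph_connected e.

Lemma geodesic_le_diameter (u v : V) :
  exists2 p, p \in gpaths e u v & (size p <= diameter e)%N.
Proof.
have [p0 p0P] : exists p, p \in gpaths e u v.
  have /connectP[p ep ->] := e_conn u v.
  case/shortenP: ep => q eq uq _.
  have sq : (size q <= #|V|)%N.
    by rewrite ltnW// -[(size q).+1]/(size (u :: q)) -(card_uniqP uq) max_card.
  by exists (Bseq sq); rewrite inE /= eq eqxx andbT.
case: (arg_minnP (fun p : #|V|.-bseq V => size p) p0P) => p pP p_min.
exists p => //; apply: (@leq_trans (gdist e u v)).
  (* The default value of [gdist] also bounds [size p], by the type of [p]. *)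
  apply: (big_ind (fun m => size p <= m)%N) => //; first exact: size_bseq.
  by move=> m m' pm pm'; rewrite leq_min pm.
apply: leq_trans (leq_bigmax u).
exact: (leq_bigmax (F := gdist e u)).
Qed.

(** This bounds the number of summands of [path_time] by the length of the path,
    hence the number of exponential factors in the Chernoff bound. *)
Lemma card_path_edges (u : V) (p : seq V) :
  (#|[pred a : edge e | val a \in path_edges u p]| <= size p)%N.
Proof.
rewrite -(size_pairmap (fun x y => [set x; y]%SET) u p).
rewrite -(fintype.card_image val_inj).
apply: leq_trans (card_size _); apply: subset_leq_card.
by apply/fintype.subsetP => _ /fintype.imageP[a + ->].
Qed.

End Geodesic.

Lemma measurable_bigmaxe d (T : measurableType d) (R : realType) (I : Type)
    (r : seq I) (P : pred I) (x : \bar R) (f : I -> T -> \bar R) :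
    (forall i, measurable_fun [set: T] (f i)) ->
  measurable_fun [set: T] (fun w => \big[Order.max/x]_(i <- r | P i) f i w).
Proof.
move=> mf; elim: r => [|i r IH].
  by under eq_fun do rewrite big_nil; exact: measurable_cst.
under eq_fun do rewrite big_cons.
case: (P i); last exact: IH.
exact: (measurable_maxe (mf i) IH).
Qed.

Lemma measurable_bigmine d (T : measurableType d) (R : realType) (I : Type)
    (r : seq I) (P : pred I) (x : \bar R) (f : I -> T -> \bar R) :
    (forall i, measurable_fun [set: T] (f i)) ->
  measurable_fun [set: T] (fun w => \big[Order.min/x]_(i <- r | P i) f i w).
Proof.
move=> mf; elim: r => [|i r IH].
  by under eq_fun do rewrite big_nil; exact: measurable_cst.
under eq_fun do rewrite big_cons.
case: (P i); last exact: IH.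
exact: (measurable_mine (mf i) IH).
Qed.

Section Passage.
Variables (V : finType) (e : rel V) (R : realType).

Lemma cover_time_le (t : edge e -> R) (s : V) (x : R) :
    (forall v, exists2 p, p \in gpaths e s v & path_time t s p <= x) ->
  (cover_time t s <= x%:E)%E.
Proof.
move=> short; apply/bigmax_leP; split => [|v _]; first exact: leNye.
have [p pP px] := short v.
apply/bigmin_leP; right; by exists p; rewrite ?lee_fin.
Qed.

Lemma measurable_path_time d (T : measurableType d) (X : edge e -> T -> R)
    (s : V) (p : seq V) :
    (forall a, measurable_fun [set: T] (X a)) ->
  measurable_fun [set: T] (fun w => path_time (X^~ w) s p).
Proof.
move=> mX; rewrite /path_time.
under eq_fun do rewrite -big_filter.
exact: measurable_sum.
Qed.

Lemma measurable_cover_time d (T : measurableType d) (X : edge e -> T -> R)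
    (s : V) :
    (forall a, measurable_fun [set: T] (X a)) ->
  measurable_fun [set: T] (fun w => cover_time (X^~ w) s).
Proof.
move=> mX; apply: measurable_bigmaxe => v; apply: measurable_bigmine => p.
by apply/measurable_EFinP; exact: measurable_path_time.
Qed.

End Passage.

(** * The union bound *)

(** At theta = 1/2 the threshold 4 ln n + 2 D yields two factors: n^(-2), of
    which n copies add up to 1 / n, and e^(-D), which absorbs 2^k because 2 <=
    e. *)
Lemma chernoff_union_budget (R : realType) (n D k : nat) :
    (0 < n)%N -> (k <= D)%N ->
  2 ^+ k * expR (- (2^-1 * (4 * ln n%:R + 2 * D%:R))) <= (n%:R ^- 2 : R).
Proof.
move=> n_gt0 kD; have n0 : 0 < n%:R :> R by rewrite ltr0n.
have -> : - (2^-1 * (4 * ln n%:R + 2 * D%:R)) =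
    - (2%:R * ln n%:R) - D%:R :> R by lra.
rewrite expRD expRN expRM_natl lnK// mulrCA.
rewrite ler_piMr ?invr_ge0 ?exprn_ge0 ?(ltW n0)//.
rewrite expRN ler_pdivrMr ?expR_gt0// mul1r -[D%:R]mulr1 expRM_natl.
apply: (@le_trans _ _ (2 ^+ D)); first by rewrite ler_weXn2l ?ler1n.
by rewrite lerXn2r ?nnegrE ?expR_ge0// -[2]/(1 + 1) expR_ge1Dx.
Qed.

Theorem lemma3 (R : realType) (d : measure_display) (T : measurableType d)
    (P : probability T R) (V : finType) (e : rel V)
    (e_sym : symmetric e) (e_irr : irreflexive e)
    (e_conn : graph_connected e)
    (n D : nat) (cardV : #|V| = n) (diamG : diameter e = D)
    (tau : edge e -> {RV P >-> R})
    (tau_indep : mutually_independent tau)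
    (tau_exp : forall a : edge e, exponential_of_mean 1 (tau a))
    (s : V) :
  ((1 - n%:R^-1)%:E <=
   P [set w | cover_time (fun a => tau a w) s
                <= (4 * ln (n%:R : R) + 2 * D%:R)%:E])%E.
Proof.
set x : R := 4 * ln n%:R + 2 * D%:R.
set A := [set w | _].
have n0 : 0 < n%:R :> R by rewrite ltr0n -cardV; apply/card_gt0P; exists s.
have mA : measurable A.
  rewrite -[A]setTI; apply: emeasurable_fun_infty_c => //.
  by apply: measurable_cover_time => a; exact: measurable_funPT.
pose geodesic v := s2val (cid2 (geodesic_le_diameter e_conn s v)).
pose late v := [set w | x <= path_time (tau^~ w) s (geodesic v)].
have mlate v : measurable (late v).
  rewrite -[late v]setTI; apply: measurable_fun_le => //.
  by apply: measurable_path_time => a; exact: measurable_funPT.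
have Plate v : (P (late v) <= (n%:R ^- 2)%:E)%E.
  have half : (1 - 2^-1 * 1)^-1 = 2 :> R.
    by rewrite mulr1 (_ : 1 - 2^-1 = 2^-1 :> R) ?invrK//; lra.
  have tail := exponential_sum_tail ltr01 tau_indep tau_exp
    (fun a => val a \in path_edges s (geodesic v)) x.
  apply: le_trans (tail 2^-1 _ _) _; [lra|lra|].
  rewrite half lee_fin.
  apply: chernoff_union_budget => //; rewrite -?cardV -?diamG.
    by apply/card_gt0P; exists s.
  apply: leq_trans (card_path_edges e s (geodesic v)) _.
  exact: (s2valP' (cid2 (geodesic_le_diameter e_conn s v))).
have notA : ~` A `<=` \bigcup_(v in [set: V]) late v.
  move=> w /= /negP; rewrite -ltNge => xw; apply: contrapT => early.
  move: xw; apply/negP; rewrite -leNgt; apply: cover_time_le => v.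
  exists (geodesic v).
    exact: (s2valP (cid2 (geodesic_le_diameter e_conn s v))).
  by rewrite leNgt; apply/negP => /ltW xv; apply: early; exists v.
rewrite -(setCK A) probability_setC; last exact: measurableC.
have PnA : (P (~` A) <= (n%:R^-1)%:E)%E.
  apply: (@le_trans _ _ (\sum_(v \in [set: V]) P (late v))%E).
    apply: content_sub_fsum => //; [exact: finite_finset|exact: measurableC].
  apply: (@le_trans _ _ (\sum_(v : V) (n%:R ^- 2)%:E)%E).
    have <- : [set` enum V] = [set: V].
      by apply/seteqP; split => // v _; rewrite /= mem_enum.
    rewrite -fsbig_seq ?enum_uniq// big_enum/=.
    by apply: lee_sum => v _; exact: Plate.
  rewrite sumEFin lee_fin sumr_const cardV -[leLHS]mulr_natr.
  by rewrite -exprVn expr2 mulfVK// gt_eqF.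
by rewrite EFinB; exact: leeB.
Qed.
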